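(* For each $n\in\mathbb N$ let $M=M_n\ge 1$ be an integer, where $M_n/n\not\to 0$ as $n\to\infty$. Let $p_M=(p_{M1},\dots,p_{MM})$ be a vector of nonnegative numbers with $\sum_{i=1}^M p_{Mi}=1$, and let $X=(X_1,\dots,X_M)$ be a multinomial$(n,p_M)$ random vector. Let $m=m_n\ge 1$ and $0=k_0<k_1<\dots<k_m=M$ be integers, all depending on $n$. Define $$g_M(u)=\sum_{i=1}^M M p_{Mi}\,\mathbf 1_{(\frac{i-1}{M},\frac{i}{M}]}(u),\quad u\in\mathbb R,$$ and $$\hat F_M(x)=\frac1M\sum_{j=1}^m (k_j-k_{j-1})\,\mathbf 1\Big[\frac{M}{n(k_j-k_{j-1})}\sum_{i=k_{j-1}+1}^{k_j}X_i\le x\Big].$$ Suppose that, as $n\to\infty$, $m/n\to 0$, $$\sup_{1\le j\le m}\frac{k_j-k_{j-1}}{M}\to 0,$$ and $$\sup_{0<u\le 1}|g_M(u)-g(u)|\to 0$$ for some limiting parent density $g$ that is continuous on $[0,1]$. Let $F$ be the distribution function of $g(U)$, where $U$ is uniformly distributed on $(0,1)$. Then, as $n\to\infty$, $\hat F_M\stackrel{w}{\to}F$ in probability.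
   Context: The number of cells $M=M_n$, the vector $p_M$, and $m,k_0,\dots,k_m$ all depend on $n$; all limits are as $n\to\infty$. $\mathbf 1[A]$ is the indicator of the event $A$ and $\mathbf 1_B(u)$ is the indicator function of the set $B$. The step function $g_M$ is called the parent density of $p_M$; a limiting parent density is a probability density $g$ on $[0,1]$ that is the limit of $g_M$ in the sense stated in the claim. The structural distribution function of $p_M$ is $F_M(x)=\frac1M\sum_{i=1}^M\mathbf 1[Mp_{Mi}\le x]$, which is the distribution function of $g_M(U)$ with $U$ uniform on $(0,1)$; $F$ denotes its weak limit, which under the uniform convergence of $g_M$ to $g$ is the distribution function of $g(U)$, i.e. $F(x)=P(g(U)\le x)$. For (random) distribution functions $\hat F_M$, ''$\hat F_M\stackrel{w}{\to}F$ in probability'' means: for all $\epsilon>0$ and all continuity points $x_0$ of $F$, $P(|\hat F_M(x_0)-F(x_0)|>\epsilon)\to 0$. *)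

(* Defs.v *)
From HB Require Import structures.
From mathcomp Require Import all_boot all_order all_algebra.
From mathcomp Require Import all_classical all_reals all_analysis.

Set Implicit Arguments.
Unset Strict Implicit.
Unset Printing Implicit Defensive.

Import Order.TTheory GRing.Theory Num.Theory.
Import numFieldNormedType.Exports.

Local Open Scope classical_set_scope.
Local Open Scope ring_scope.

(* Cells are indexed by i : 'I_M, counting from 0: the i-th cell of the usual
   1-based numbering is the ordinal of value i - 1. *)

Definition probability_vector (R : realType) (M : nat) (p : 'I_M -> R) : Prop :=
  (forall i, 0 <= p i) /\ \sum_(i < M) p i = 1.

Definition multinomial_pmf (R : realType) (n M : nat) (p : 'I_M -> R)
    (x : 'I_M -> nat) : R :=
  if (\sum_(i < M) x i == n)%N then
    n`!%:R / (\prod_(i < M) (x i)`!)%:R * \prod_(i < M) p i ^+ x i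
  else 0.

Definition is_multinomial (d : measure_display) (T : measurableType d)
    (R : realType) (P : probability T R) (n M : nat) (p : 'I_M -> R)
    (X : 'I_M -> {RV P >-> nat}) : Prop :=
  forall x : 'I_M -> nat,
    P [set w | forall i, X i w = x i] = (multinomial_pmf n p x)%:E.

Definition parent_density (R : realType) (M : nat) (p : 'I_M -> R) (u : R) : R :=
  \sum_(i < M) M%:R * p i * \1_`](i%:R / M%:R), (i.+1%:R / M%:R)] u.

(* Increasing cut points 0 = k_0 < k_1 < ... < k_m = M; the values of k beyond
   m are irrelevant. *)
Definition grouping (M m : nat) (k : nat -> nat) : Prop :=
  [/\ k 0%N = 0%N, k m = M & forall j, (j < m)%N -> (k j < k j.+1)%N].

(* The j-th group (j < m, counting from 0) consists of the ordinals i with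
   k j <= i < k j.+1; x is the vector of cell counts. *)
Definition grouped_cdf (R : realType) (n M m : nat) (k : nat -> nat)
    (x : 'I_M -> nat) (t : R) : R :=
  M%:R^-1 * \sum_(j < m) (k j.+1 - k j)%:R *
    (M%:R / (n%:R * (k j.+1 - k j)%:R) *
       (\sum_(i < M | (k j <= i < k j.+1)%N) x i)%:R <= t)%R%:R.

Definition density01 (R : realType) (g : R -> R) : Prop :=
  (forall u, 0 <= u <= 1 -> 0 <= g u) /\
  (\int[lebesgue_measure]_(u in `[0%R, 1%R]) (g u)%:E = 1)%E.

Definition uniform01 (d : measure_display) (T : measurableType d)
    (R : realType) (Q : probability T R) (U : {RV Q >-> R}) : Prop :=
  forall A : set R, measurable A ->
    distribution Q U A = uniform_prob (@ltr01 R) A.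

Definition weak_cvg_in_probability (R : realType) (d : nat -> measure_display)
    (T : forall n, measurableType (d n)) (P : forall n, probability (T n) R)
    (Fhat : forall n, T n -> R -> R) (F : R -> R) : Prop :=
  forall e : R, 0 < e -> forall x0 : R, {for x0, continuous F} ->
    (fun n => P n [set w | e < `|Fhat n w x0 - F x0|]) @ \oo --> 0%E.

(* Main.v *)
Require Import Defs.
From HB Require Import structures.
From mathcomp Require Import all_boot all_order all_algebra.
From mathcomp Require Import all_classical all_reals all_analysis.
From mathcomp Require Import ring lra.

Set Implicit Arguments.
Unset Strict Implicit.
Unset Printing Implicit Defensive.

Import Order.TTheory GRing.Theory Num.Theory.
Import numFieldNormedType.Exports.

Local Open Scope classical_set_scope.
Local Open Scope ring_scope.

(** Write N_j for the number of observations in group j, q_j for the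
    probability of the group, L_j = k_j - k_(j-1) for its number of cells and
    w_j = L_j / M for its relative size.  The estimate on group j is
    Z_j = (N_j / n) / w_j, the corresponding mean is b_j = q_j / w_j, and the
    grouped distribution function at t is the sum of the w_j with Z_j <= t.

    Random part.  The weighted deviation S = sum_j w_j |Z_j - b_j| equals
    (1/n) sum_j |N_j - n q_j|.  Since the variance of N_j is at most n q_j and
    |D| <= (D^2 / c + c) / 2, the mean of S is at most
    (1/c + c m / n) / 2 for every c > 0, which is arbitrarily small as soon as
    m / n is (mean_total_deviation).  Only the number of groups matters: small
    groups have noisy Z_j, but also a small weight w_j.

    Deterministic part.  The mean b_j is an average of the values M p_i over
    the cells of the group, that is, of values of the parent density at points
    of the interval I_j = ](k_(j-1))/M, k_j/M].  By the uniform convergence to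
    g, the uniform continuity of g and the small mesh, b_j is within delta of
    g on all of I_j (group_mean_close).  As U falls in I_j with probability
    w_j, the distribution function F of g(U) is compared with the sums of the
    w_j such that b_j <= t (cdf_bounds_groups).  An indicator 1[Z_j <= t]
    exceeds 1[b_j <= t + delta] only if |Z_j - b_j| > delta, at a cost
    controlled by S / delta (grouped_cdf_sandwich).  Together,

      F(t - 2 delta) - S / delta <= Fhat(t) <= F(t + 2 delta) + S / delta.

    At a continuity point t of F, choose delta so that F(t - 2 delta) and
    F(t + 2 delta) are within e / 2 of F(t).  Then |Fhat(t) - F(t)| > e forces
    S > e delta / 2, whose probability tends to 0 by Markov's inequality.

    The multinomial law is given by its mass function; moments are computed by
    throwing the n balls one at a time, and probabilities of events are turned
    into such means because the law has finite support
    (multinomial_prob_le). *)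

(** * Means under the multinomial law *)
Section MultinomialMean.
Variables (R : realType) (M : nat) (p : 'I_M -> R).
Implicit Types (f h : ('I_M -> nat) -> R) (x y : 'I_M -> nat).

Definition add_ball y (i : 'I_M) : 'I_M -> nat := fun j => (y j + (j == i))%N.

(** The mean of f under the multinomial law, computed by conditioning on the
    cell of one ball: this recursion makes moments easy, whereas the explicit
    mass function does not.  It is a mean of f under a probability law only
    when p is a probability vector. *)
Fixpoint multinomial_mean n f : R :=
  if n is n'.+1 then
    \sum_(i < M) p i * multinomial_mean n' (fun y => f (add_ball y i))
  else f (fun=> 0%N).

Lemma sum_add_ball y i : (\sum_(j < M) add_ball y i j = (\sum_(j < M) y j).+1)%N.
Proof.
rewrite big_split/= -addn1; congr addn.
by rewrite (bigD1 i)//= eqxx big1 ?addn0// => j /negbTE ->.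
Qed.

Lemma eq_multinomial_mean n f h :
  (forall y, (\sum_(j < M) y j = n)%N -> f y = h y) ->
  multinomial_mean n f = multinomial_mean n h.
Proof.
elim: n f h => [|n IHn] f h fh /=; first by apply: fh; rewrite big1.
apply: eq_bigr => i _; congr (_ * _); apply: IHn => y yn.
by apply: fh; rewrite sum_add_ball yn.
Qed.

Lemma multinomial_mean_linear n a f h :
  multinomial_mean n (fun y => a * f y + h y) =
  a * multinomial_mean n f + multinomial_mean n h.
Proof.
elim: n f h => //= n IHn f h.
rewrite mulr_sumr -big_split/=; apply: eq_bigr => i _.
by rewrite (IHn (fun y => f (add_ball y i)) (fun y => h (add_ball y i)));
  ring.
Qed.

Lemma multinomial_mean0 n : multinomial_mean n (fun=> 0) = 0.
Proof. by elim: n => //= n ->; rewrite big1// => i _; rewrite mulr0. Qed.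

Lemma multinomial_meanZ n a f :
  multinomial_mean n (fun y => a * f y) = a * multinomial_mean n f.
Proof.
rewrite -[RHS]addr0 -(multinomial_mean0 n) -multinomial_mean_linear.
by apply: eq_multinomial_mean => y _; rewrite addr0.
Qed.

Lemma multinomial_mean_sum n (I : Type) (r : seq I) (P : pred I)
    (f : I -> ('I_M -> nat) -> R) :
  multinomial_mean n (fun y => \sum_(i <- r | P i) f i y) =
  \sum_(i <- r | P i) multinomial_mean n (f i).
Proof.
elim: r => [|i r IHr].
  rewrite big_nil -[RHS](multinomial_mean0 n).
  by apply: eq_multinomial_mean => y _; rewrite big_nil.
rewrite big_cons; case: ifPn => Pi; rewrite -IHr; last first.
  by apply: eq_multinomial_mean => y _; rewrite big_cons (negbTE Pi).
rewrite -[multinomial_mean n (f i)]mul1r -multinomial_mean_linear.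
by apply: eq_multinomial_mean => y _; rewrite big_cons Pi mul1r.
Qed.

(** Links the recursion to the mass function: both satisfy
    pmf_(n+1) x = sum_i p_i pmf_n (x - e_i), which for the mass function comes
    from distributing n + 1 = sum_i x_i over the multinomial coefficient. *)
Lemma multinomial_mean_point n x :
  multinomial_mean n (fun y => `[< y = x >]%:R) = multinomial_pmf n p x.
Proof.
elim: n x => [|n IHn] x.
  rewrite /multinomial_pmf/=; case: asboolP => [<-|x0].
    by rewrite big1// eqxx !big1//= ?divr1 ?mulr1.
  case: ifPn => //; rewrite sum_nat_eq0 => /forallP x0'; exfalso; apply: x0.
  by apply/funext => j; move: (x0' j) => /= /eqP.
have predE i : (0 < x i)%N ->
    exists2 z, x = add_ball z i & forall y, (add_ball y i = x) = (y = z).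
  move=> xi; exists (fun j => x j - (j == i))%N.
    by apply/funext => j; rewrite /add_ball; case: eqP => [->|_]/=;
      rewrite ?subnK// subn0 addn0.
  move=> y; apply/propext; split => [<-|->].
    by apply/funext => j; rewrite /add_ball addnK.
  apply/funext => j; rewrite /add_ball; case: eqP => [->|_]/=;
    by rewrite ?subnK// subn0 addn0.
(* This form of the i-th term is also right when x i = 0, where both the
   term and the factor x i vanish. *)
transitivity (\sum_(i < M) (\sum_(j < M) x j == n.+1)%N%:R *
    (n`!%:R * (x i)%:R / (\prod_(j < M) (x j)`!)%:R * \prod_(j < M) p j ^+ x j)).
  rewrite /=; apply: eq_bigr => i _; have [xi0|xi] := posnP (x i).
    rewrite xi0 mulr0 !mul0r mulr0.
    rewrite (_ : multinomial_mean _ _ = 0) ?mulr0//.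
    rewrite -(multinomial_mean0 n); apply: eq_multinomial_mean => y _.
    case: asboolP => // yx; move: xi0; rewrite -yx /add_ball eqxx.
    by rewrite addn1.
  have [z xz zE] := predE i xi.
  transitivity (p i * multinomial_pmf n p z).
    congr (_ * _); rewrite -IHn; apply: eq_multinomial_mean => y _.
    by rewrite zE.
  rewrite {xi zE} xz sum_add_ball eqSS /multinomial_pmf; case: ifP => _.
    rewrite mul1r.
    have -> : (\prod_(j < M) (add_ball z i j)`! =
        (z i).+1 * (z i)`! * \prod_(j < M | j != i) (z j)`!)%N.
      rewrite (bigD1 i)//= /add_ball eqxx addn1 factS; congr (_ * _)%N.
      by apply: eq_bigr => j /negbTE ->; rewrite addn0.
    have -> : \prod_(j < M) p j ^+ add_ball z i j =
        p i * \prod_(j < M) p j ^+ z j.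
      rewrite (bigD1 i)//= [in RHS](bigD1 i)//= mulrA -exprS.
      rewrite /add_ball eqxx addn1; congr (_ * _).
      by apply: eq_bigr => j /negbTE ->; rewrite addn0.
    rewrite [(\prod_(j < M) (z j)`!)%N](bigD1 i)//= !natrM.
    rewrite /add_ball eqxx addn1.
    have : (\prod_(j < M | j != i) (z j)`!)%:R != 0 :> R.
      by rewrite pnatr_eq0 -lt0n prodn_gt0// => j; exact: fact_gt0.
    have : (z i)`!%:R != 0 :> R by rewrite pnatr_eq0 -lt0n fact_gt0.
    have : (z i).+1%:R != 0 :> R by rewrite pnatr_eq0.
    move=> ? ? ?; field; exact/and3P.
  by rewrite mul0r mulr0.
rewrite /multinomial_pmf -mulr_sumr; case: eqP => [xn|_]; last by rewrite mul0r.
rewrite mul1r -!mulr_suml -mulr_sumr -natr_sum xn factS natrM.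
by rewrite [_.+1%:R * _]mulrC.
Qed.

Hypothesis p_ge0 : forall i, 0 <= p i.

Lemma le_multinomial_mean n f h :
  (forall y, (\sum_(j < M) y j = n)%N -> f y <= h y) ->
  multinomial_mean n f <= multinomial_mean n h.
Proof.
elim: n f h => [|n IHn] f h fh /=; first by apply: fh; rewrite big1.
apply: ler_sum => i _; apply: ler_wpM2l => //; apply: IHn => y yn.
by apply: fh; rewrite sum_add_ball yn.
Qed.

Hypothesis p_sum1 : \sum_(i < M) p i = 1.

Lemma multinomial_mean_cst n c : multinomial_mean n (fun=> c) = c.
Proof. by elim: n => //= n ->; rewrite -mulr_suml p_sum1 mul1r. Qed.

(** A centred weight a makes the linear statistic sum_i y_i a_i a martingale as
    the balls are thrown, so the cross terms vanish and its variance adds up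
    ball by ball. *)
Lemma multinomial_variance_linear n (a : 'I_M -> R) :
  \sum_(i < M) p i * a i = 0 ->
  multinomial_mean n (fun y => (\sum_(i < M) (y i)%:R * a i) ^+ 2) =
    n%:R * \sum_(i < M) p i * a i ^+ 2.
Proof.
move=> a0; pose l y := \sum_(i < M) (y i)%:R * a i.
have lS y i : l (add_ball y i) = l y + a i.
  rewrite /l /add_ball; under eq_bigr do rewrite natrD mulrDl.
  rewrite big_split/=; congr (_ + _).
  rewrite (bigD1 i)//= eqxx mul1r big1 ?addr0// => j /negbTE ->.
  by rewrite mul0r.
have El k : multinomial_mean k l = 0.
  elim: k => /= [|k IHk].
    by rewrite /l big1// => i _; rewrite mul0r.
  transitivity (\sum_(i < M) p i * (multinomial_mean k l + a i)).
    apply: eq_bigr => i _; congr (_ * _).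
    rewrite -(multinomial_mean_cst k (a i)) -[X in _ = X + _]mul1r.
    rewrite -multinomial_mean_linear; apply: eq_multinomial_mean => y _.
    by rewrite lS mul1r.
  by rewrite IHk; under eq_bigr do rewrite add0r.
rewrite -/(multinomial_mean n (fun y => l y ^+ 2)).
elim: n => [|n IHn].
  by rewrite /= /l big1 ?expr0n ?mul0r// => i _; rewrite mul0r.
transitivity (\sum_(i < M) p i *
    (multinomial_mean n (fun y => l y ^+ 2) + a i ^+ 2)).
  apply: eq_bigr => i _; congr (_ * _).
  transitivity (multinomial_mean n
    (fun y => (a i *+ 2) * l y + (1 * l y ^+ 2 + a i ^+ 2))).
    by apply: eq_multinomial_mean => y _; rewrite -/(l _) lS; ring.
  by rewrite !multinomial_mean_linear El mulr0 add0r mul1r multinomial_mean_cst.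
under eq_bigr do rewrite mulrDr.
by rewrite big_split/= -mulr_suml p_sum1 mul1r IHn -[in RHS]natr1 mulrDl mul1r.
Qed.

(** The number of balls in G minus its mean is the linear statistic with
    weights 1[i in G] - q, where q is the probability of G; its exact variance
    is n q (1 - q). *)
Lemma multinomial_variance_group_le n (G : pred 'I_M) :
  multinomial_mean n (fun y =>
    ((\sum_(i < M | G i) y i)%:R - n%:R * \sum_(i < M | G i) p i) ^+ 2) <=
  n%:R * \sum_(i < M | G i) p i.
Proof.
set q := \sum_(i < M | G i) p i.
pose a i : R := (G i)%:R - q.
have qE : \sum_(i < M) p i * (G i)%:R = q.
  by rewrite /q [RHS]big_mkcond; apply: eq_bigr => i _; rewrite mulr_natr mulrb.
have a0 : \sum_(i < M) p i * a i = 0.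
  under eq_bigr do rewrite mulrBr.
  by rewrite sumrB qE -mulr_suml p_sum1 mul1r subrr.
have E2 := multinomial_variance_linear n a0.
rewrite (eq_multinomial_mean (h := fun y => (\sum_(i < M) (y i)%:R * a i) ^+ 2)).
  rewrite E2; apply: ler_wpM2l => //.
  have -> : \sum_(i < M) p i * a i ^+ 2 = q - q ^+ 2.
    transitivity (\sum_(i < M) (p i * (G i)%:R - q * (p i * (G i)%:R) *+ 2 +
        q ^+ 2 * p i)).
      by apply: eq_bigr => i _; rewrite /a; case: (G i) => /=; ring.
    rewrite big_split/= sumrB -mulr_sumr p_sum1 qE sumrMnl -mulr_sumr qE; ring.
  by rewrite lerBlDr lerDl sqr_ge0.
move=> y yn; congr (_ ^+ 2); rewrite /a.
under [RHS]eq_bigr do rewrite mulrBr.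
rewrite sumrB -mulr_suml -natr_sum yn natr_sum; congr (_ - _).
by rewrite big_mkcond; apply: eq_bigr => i _; rewrite mulr_natr mulrb.
Qed.

End MultinomialMean.

(** * Probabilities of events on multinomial counts *)
Section MultinomialLaw.
Context (d : measure_display) (T : measurableType d) (R : realType)
  (P : probability T R) (n M : nat) (p : 'I_M -> R) (X : 'I_M -> {RV P >-> nat}).

Lemma measurable_counts_point (x : 'I_M -> nat) :
  measurable [set w | forall i, X i w = x i].
Proof.
rewrite (_ : [set w | _] = \bigcap_(i in [set: 'I_M]) (X i @^-1` [set x i])).
  apply: fin_bigcap_measurable => // i _; rewrite -[_ @^-1` _]setTI.
  exact: measurable_funPT.
by apply/seteqP; split => w /= Xw i => [_|]; exact: Xw.
Qed.

Lemma measurable_counts (A : pred ('I_M -> nat)) :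
  measurable [set w | A (fun i => X i w)].
Proof.
rewrite (_ : [set w | _] = \bigcup_(z : {ffun 'I_M -> nat})
    (if A z then [set w | forall i, X i w = z i] else set0)).
  apply: countable_bigcupT_measurable => // z.
  by case: ifP => // _; exact: measurable_counts_point.
apply/seteqP; split => [w Aw|w [z _]]/=.
  exists [ffun i => X i w] => //.
  have -> : ([ffun i => X i w] : 'I_M -> nat) = fun i => X i w.
    by apply/funext => i; rewrite ffunE.
  by rewrite Aw.
case: ifP => // Az /= Xz; suff -> : (fun i => X i w) = z by [].
exact/funext.
Qed.

Hypothesis p_prob : probability_vector p.
Hypothesis X_multinomial : is_multinomial n p X.

(** Count vectors of total n take values in 0, ..., n, so there are finitely
    many of them and the probability is a finite sum of point masses. *)
Lemma multinomial_prob_total (A : pred ('I_M -> nat)) :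
  P [set w | (\sum_(i < M) X i w == n)%N && A (fun i => X i w)] =
  (multinomial_mean p n (fun y => (A y)%:R))%:E.
Proof.
pose J := {ffun 'I_M -> 'I_n.+1}; pose c (z : J) : 'I_M -> nat := fun i => z i.
pose r := [seq z <- enum {: J} | (\sum_(i < M) c z i == n)%N && A (c z)].
have c_inj (z z' : J) : c z = c z' -> z = z'.
  move=> zz'; apply/ffunP => i; apply/val_inj.
  by move/(congr1 (fun f => f i)): zz'.
have r_uniq : uniq r by rewrite filter_uniq// enum_uniq.
have exJ (y : 'I_M -> nat) : (\sum_(i < M) y i = n)%N -> exists z : J, c z = y.
  move=> yn; exists [ffun i => inord (y i)]; apply/funext => i.
  rewrite /c ffunE inordK// ltnS -yn (bigD1 i)//=; exact: leq_addr.
rewrite (_ : [set w | _] =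
    \bigcup_(z in [set` r]) [set w | forall i, X i w = c z i]); last first.
  apply/seteqP; split => [w /= /andP[/eqP Xn AX]|w [z]]/=.
    have [z zX] := exJ _ Xn; exists z; last by rewrite zX.
    by rewrite /= mem_filter mem_enum zX Xn eqxx AX.
  rewrite mem_filter => /andP[zA _] /funext Xz.
  by rewrite (eq_bigr (c z)) ?Xz// => i _; rewrite -Xz.
rewrite measure_fin_bigcup//=; first last.
- by move=> z _; exact: measurable_counts_point.
- move=> z z' _ _ [w []] /= Xz Xz'; apply: c_inj; apply/funext => i.
  by rewrite -Xz -Xz'.
rewrite -fsbig_seq//=.
under eq_bigr do rewrite X_multinomial -multinomial_mean_point.
rewrite sumEFin -multinomial_mean_sum; congr EFin.
apply: eq_multinomial_mean => y yn; have [z zy] := exJ _ yn.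
have [Ay|Ay] := boolP (A y); last first.
  rewrite big_seq big1// => z'; rewrite mem_filter => /andP[/andP[_ Az'] _].
  by case: asboolP => // yz'; move: Ay; rewrite yz' Az'.
rewrite (bigD1_seq z)//=; last by rewrite mem_filter mem_enum zy yn eqxx Ay.
rewrite big1 ?addr0 => [|z' z'z]; first by rewrite zy; case: asboolP.
by case: asboolP => // yz'; case/eqP: z'z; apply: c_inj; rewrite zy -yz'.
Qed.

(** Taking the full event in multinomial_prob_total shows that the counts have
    total n almost surely, so the restriction on the total can be dropped. *)
Lemma multinomial_prob_le (A : pred ('I_M -> nat)) :
  (P [set w | A (fun i => X i w)] <=
    (multinomial_mean p n (fun y => (A y)%:R))%:E)%E.
Proof.
have [_ p1] := p_prob.
pose S := [set w | (\sum_(i < M) X i w == n)%N].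
have mS : measurable S.
  exact: (measurable_counts (fun x => \sum_(i < M) x i == n)%N).
have PS : P (~` S) = 0%E.
  rewrite probability_setC// (_ : P S = 1%E) ?subee//.
  transitivity (P [set w | (\sum_(i < M) X i w == n)%N && xpredT (fun i => X i w)]).
    by congr (P _); apply/seteqP; split => w /=; rewrite andbT.
  by rewrite (multinomial_prob_total xpredT)/= multinomial_mean_cst.
rewrite -multinomial_prob_total.
pose B := [set w | (\sum_(i < M) X i w == n)%N && A (fun i => X i w)].
have mB : measurable B.
  exact: (measurable_counts (fun x => (\sum_(i < M) x i == n)%N && A x)).
rewrite -/B -[leRHS]adde0 -PS.
apply: le_trans (measureU2 _ _ _) => //; last exact: measurableC.
apply: le_measure; rewrite ?inE//.
- exact: measurable_counts.
- by apply: measurableU => //; exact: measurableC.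
- move=> w /= Aw; have [Sw|Sw] := boolP (\sum_(i < M) X i w == n)%N.
    by left; rewrite /B/= Sw.
  by right; apply/negP.
Qed.

End MultinomialLaw.

(** * Partition of the cells into groups *)
Section Grouping.
Variables (R : realType) (M m : nat) (k : nat -> nat).
Hypotheses (M_gt0 : (0 < M)%N) (k_grouping : grouping M m k).

Definition group_weight j : R := (k j.+1 - k j)%:R / M%:R.

Let M_neq0 : M%:R != 0 :> R. Proof. by rewrite pnatr_eq0 -lt0n. Qed.

Lemma grouping_lt j : (j < m)%N -> (k j < k j.+1)%N.
Proof. by case: k_grouping => _ _; exact. Qed.

Lemma grouping_le_size j : (j <= m)%N -> (k j <= M)%N.
Proof.
have [_ <- _] := k_grouping.
elim: m j grouping_lt => [j _|m' IHm j lt_k]; first by rewrite leqn0 => /eqP ->.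
rewrite leq_eqVlt => /predU1P[->//|jm].
apply: leq_trans (ltnW (lt_k _ (ltnSn m'))).
by apply: IHm => // i im; apply: lt_k; exact: ltnW.
Qed.

Lemma group_weight_gt0 j : (j < m)%N -> 0 < group_weight j.
Proof. by move=> /grouping_lt jm; rewrite divr_gt0// ltr0n// subn_gt0. Qed.

Lemma group_weightE j : (j < m)%N ->
  group_weight j = (k j.+1)%:R / M%:R - (k j)%:R / M%:R.
Proof. by move=> /grouping_lt /ltnW jm; rewrite /group_weight natrB// mulrBl. Qed.

Lemma sum_group_weight : \sum_(j < m) group_weight j = 1.
Proof.
have [k0 km _] := k_grouping.
under eq_bigr => j _ do rewrite group_weightE//.
rewrite -(big_mkord xpredT (fun j => (k j.+1)%:R / M%:R - (k j)%:R / M%:R)).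
rewrite (telescope_sumr (fun j => (k j)%:R / M%:R))// k0 km mul0r subr0.
by rewrite divff.
Qed.

Lemma group_indicE j i : (j < m)%N ->
  (k j <= i < k j.+1)%N%:R = (i < k j.+1)%N%:R - (i < k j)%N%:R :> R.
Proof.
move=> /grouping_lt /ltnW kj; have [ki|ik] := leqP (k j) i; rewrite ?subr0//=.
by rewrite (leq_trans ik kj) subrr.
Qed.

(** Every cell lies in exactly one group: the indicators of the groups are
    differences of the indicators of i < k j, and telescope to 1. *)
Lemma sum_group_sums (a : 'I_M -> R) :
  \sum_(j < m) \sum_(i < M | (k j <= i < k j.+1)%N) a i = \sum_(i < M) a i.
Proof.
have [k0 km _] := k_grouping.
under eq_bigr do rewrite big_mkcond.
rewrite exchange_big; apply: eq_bigr => i _ /=.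
transitivity (a i * \sum_(j < m) ((i < k j.+1)%N%:R - (i < k j)%N%:R)).
  rewrite mulr_sumr; apply: eq_bigr => j _.
  by rewrite -group_indicE// mulr_natr mulrb.
rewrite -(big_mkord xpredT (fun j => (i < k j.+1)%N%:R - (i < k j)%N%:R)).
rewrite (telescope_sumr (fun j => (i < k j)%N%:R))// k0 km ltn_ord.
by rewrite subr0 mulr1.
Qed.

Lemma card_group j : (j < m)%N ->
  \sum_(i < M | (k j <= i < k j.+1)%N) (1 : R) = (k j.+1 - k j)%:R.
Proof.
move=> jm; have below a : (a <= M)%N -> \sum_(i < M) ((i < a)%N%:R : R) = a%:R.
  move=> aM; transitivity (\sum_(i < M | (i < a)%N) (1 : R)).
    by rewrite [RHS]big_mkcond; apply: eq_bigr => i _; case: ifP.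
  by rewrite big_ord_narrow// sumr_const card_ord.
rewrite big_mkcond natrB; last exact/ltnW/grouping_lt.
rewrite -!below ?grouping_le_size//; last exact: ltnW.
by rewrite -sumrB; apply: eq_bigr => i _; rewrite -group_indicE//; case: ifP.
Qed.

Lemma group_cover (u : R) : 0 < u <= 1 ->
  exists2 j, (j < m)%N & (k j)%:R / M%:R < u <= (k j.+1)%:R / M%:R.
Proof.
move=> /andP[u0 u1]; have [k0 km _] := k_grouping.
have ex : exists j, u <= (k j)%:R / M%:R by exists m; rewrite km divff.
case: (ex_minnP ex) => -[|j] uj jmin.
  by move: u0; rewrite ltNge (le_trans uj)// k0 mul0r.
exists j; first by apply: jmin; rewrite km divff.
by rewrite uj andbT ltNge; apply/negP => /jmin; rewrite ltnn.
Qed.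

Lemma group_average (a : 'I_M -> R) j (c e : R) : (j < m)%N ->
  (forall i : 'I_M, (k j <= i < k j.+1)%N -> `|a i - c| <= e) ->
  `|(k j.+1 - k j)%:R^-1 * (\sum_(i < M | (k j <= i < k j.+1)%N) a i) - c| <= e.
Proof.
move=> jm ac; set L := (_ - _)%:R.
have L_gt0 : 0 < L :> R by rewrite ltr0n subn_gt0 grouping_lt.
have -> : L^-1 * (\sum_(i < M | (k j <= i < k j.+1)%N) a i) - c =
    L^-1 * \sum_(i < M | (k j <= i < k j.+1)%N) (a i - c).
  rewrite {1}(_ : c = L^-1 * \sum_(i < M | (k j <= i < k j.+1)%N) (c * 1)); last first.
    by rewrite -mulr_sumr card_group// mulrCA mulVf ?mulr1// gt_eqF.
  by rewrite -mulrBr -sumrB mulr1.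
rewrite normrM normfV (gtr0_norm L_gt0) ler_pdivrMl// mulrC.
apply: le_trans (ler_norm_sum _ _ _) _.
apply: le_trans (ler_sum _ ac) _.
rewrite (eq_bigr (fun i => e * 1)) => [|i _]; last by rewrite mulr1.
by rewrite -mulr_sumr card_group.
Qed.

End Grouping.

(** * Deviation of the group estimates *)
Section Deviation.
Variables (R : realType) (n M m : nat) (k : nat -> nat) (p : 'I_M -> R).
Hypotheses (n_gt0 : (0 < n)%N) (M_gt0 : (0 < M)%N)
  (k_grouping : grouping M m k) (p_prob : probability_vector p).

Definition group_mean j : R := M%:R *
  ((k j.+1 - k j)%:R^-1 * \sum_(i < M | (k j <= i < k j.+1)%N) p i).

(** The sum of the distances between group estimates and group means, weighted
    by the sizes of the groups: see total_deviationE.  In this form the sizes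
    of the groups cancel. *)
Definition total_deviation (x : 'I_M -> nat) : R := n%:R^-1 *
  \sum_(j < m) `|(\sum_(i < M | (k j <= i < k j.+1)%N) x i)%:R -
                 n%:R * \sum_(i < M | (k j <= i < k j.+1)%N) p i|.

(** Applies |D| <= (D^2 / c + c) / 2 with the same c in all groups, so that the
    variances n q_j sum to n; the constants c give the term in m / n. *)
Lemma mean_total_deviation c : 0 < c ->
  multinomial_mean p n total_deviation <= (c^-1 + c * (m%:R / n%:R)) / 2.
Proof.
move=> c0; have [p_ge0 p_sum1] := p_prob.
rewrite multinomial_meanZ multinomial_mean_sum.
pose q j := \sum_(i < M | (k j <= i < k j.+1)%N) p i.
have -> : (c^-1 + c * (m%:R / n%:R)) / 2 =
    n%:R^-1 * \sum_(j < m) (c^-1 / 2 * (n%:R * q j) + c / 2).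
  have nn0 : n%:R != 0 :> R by rewrite pnatr_eq0 -lt0n.
  rewrite big_split/= -!mulr_sumr (sum_group_sums k_grouping) p_sum1.
  by rewrite sumr_const card_ord -[_ *+ m]mulr_natr; field; rewrite nn0 gt_eqF.
rewrite ler_wpM2l ?invr_ge0//; apply: ler_sum => j _.
pose D (y : 'I_M -> nat) : R :=
  (\sum_(i < M | (k j <= i < k j.+1)%N) y i)%:R - n%:R * q j.
apply: (@le_trans _ _ (multinomial_mean p n
    (fun y => c^-1 / 2 * D y ^+ 2 + c / 2))).
  apply: le_multinomial_mean => // y _; rewrite -/(D y).
  have -> : c^-1 / 2 * D y ^+ 2 + c / 2 =
      `|D y| + c^-1 / 2 * (`|D y| - c) ^+ 2.
    by rewrite -[D y ^+ 2]real_normK ?num_real//; field; rewrite gt_eqF.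
  by rewrite lerDl mulr_ge0 ?sqr_ge0// divr_ge0// invr_ge0 ltW.
rewrite multinomial_mean_linear multinomial_mean_cst// lerD2r.
rewrite ler_wpM2l ?divr_ge0 ?invr_ge0 ?(ltW c0)//.
exact: multinomial_variance_group_le.
Qed.

Definition group_estimate (x : 'I_M -> nat) j : R :=
  M%:R / (n%:R * (k j.+1 - k j)%:R) *
    (\sum_(i < M | (k j <= i < k j.+1)%N) x i)%:R.

Lemma grouped_cdfE (x : 'I_M -> nat) t : grouped_cdf n m k x t =
  \sum_(j < m) group_weight R M k j * (group_estimate x j <= t)%R%:R.
Proof.
rewrite /grouped_cdf mulr_sumr; apply: eq_bigr => j _.
by rewrite mulrA [M%:R^-1 * _]mulrC.
Qed.

Lemma total_deviationE (x : 'I_M -> nat) : total_deviation x =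
  \sum_(j < m) group_weight R M k j * `|group_estimate x j - group_mean j|.
Proof.
rewrite /total_deviation mulr_sumr; apply: eq_bigr => j _.
have w0 := group_weight_gt0 R M_gt0 k_grouping (ltn_ord j).
rewrite -[n%:R^-1]ger0_norm ?invr_ge0// -(gtr0_norm w0) -!normrM; congr `|_|.
have nn0 : n%:R != 0 :> R by rewrite pnatr_eq0 -lt0n.
have M0 : M%:R != 0 :> R by rewrite pnatr_eq0 -lt0n.
have L0 : (k j.+1 - k j)%:R != 0 :> R.
  by rewrite pnatr_eq0 -lt0n subn_gt0 (grouping_lt k_grouping).
rewrite /group_weight /group_estimate /group_mean; field.
by rewrite nn0 M0 L0.
Qed.

(** Where the estimate and the mean of a group are on different sides of a gap
    of width delta, their distance over delta is at least 1, hence pays for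
    the difference of the indicators. *)
Lemma grouped_cdf_sandwich (x : 'I_M -> nat) t delta : 0 < delta ->
  \sum_(j < m | group_mean j <= t - delta) group_weight R M k j -
    total_deviation x / delta <= grouped_cdf n m k x t /\
  grouped_cdf n m k x t <=
    \sum_(j < m | group_mean j <= t + delta) group_weight R M k j +
    total_deviation x / delta.
Proof.
move=> delta0; rewrite total_deviationE grouped_cdfE mulr_suml lerBlDr.
rewrite !(big_mkcond (fun j => group_mean _ <= _)) -!big_split/=.
split; apply: ler_sum => j _;
  have w0 := group_weight_gt0 R M_gt0 k_grouping (ltn_ord j);
  set Z := group_estimate _ _; set b := group_mean _.
- have jump : (b <= t - delta)%R%:R <= (Z <= t)%R%:R + `|Z - b| / delta.
    have [bt|bt] := leP b; have [Zt|Zt] := leP Z;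
      rewrite ?add0r ?lerDl ?addr_ge0 ?divr_ge0 ?(ltW delta0)//.
    rewrite ler_pdivlMr// mul1r; apply: le_trans (ler_norm _); lra.
  have := ler_wpM2l (ltW w0) jump.
  by rewrite mulrDr mulrA; case: (b <= _); rewrite ?mulr1 ?mulr0.
- have jump : (Z <= t)%R%:R <= (b <= t + delta)%R%:R + `|Z - b| / delta.
    have [bt|bt] := leP b; have [Zt|Zt] := leP Z;
      rewrite ?add0r ?lerDl ?addr_ge0 ?divr_ge0 ?(ltW delta0)//.
    rewrite ler_pdivlMr// mul1r distrC; apply: le_trans (ler_norm _); lra.
  have := ler_wpM2l (ltW w0) jump.
  by rewrite mulrDr mulrA; case: (b <= _); rewrite ?mulr1 ?mulr0.
Qed.

End Deviation.

(** * Comparison of the group means with the limiting density *)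
Lemma parent_density_right_end (R : realType) (M : nat) (p : 'I_M -> R) (i : 'I_M) :
  parent_density p (i.+1%:R / M%:R) = M%:R * p i.
Proof.
have M_gt0 : 0 < M%:R :> R by rewrite ltr0n (leq_ltn_trans _ (ltn_ord i)).
have cell (j : 'I_M) :
    (i.+1%:R / M%:R \in `](j%:R / M%:R : R), (j.+1%:R / M%:R)]%classic) =
      (j == i).
  apply/idP/eqP => [|->]; rewrite inE/= in_itv/= ?ltr_pM2r ?ler_pM2r ?invr_gt0//.
    by rewrite ltr_nat ler_nat !ltnS -eqn_leq => /eqP /val_inj.
  by rewrite ltr_nat ltnSn lexx.
rewrite /parent_density (bigD1 i)//= big1 => [|j /negbTE ji].
  by rewrite addr0 indicE cell eqxx mulr1.
by rewrite indicE cell ji mulr0.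
Qed.

(** The mean of a group averages the parent density over the right ends of its
    cells; these lie in the interval of the group, as u does, so each of the
    averaged values is close to g u. *)
Lemma group_mean_close (R : realType) (M m : nat) (k : nat -> nat) (p : 'I_M -> R)
    (g : R -> R) (h e1 e2 : R) :
  (0 < M)%N -> grouping M m k ->
  (forall j, (j < m)%N -> group_weight R M k j < h) ->
  (forall u, 0 < u <= 1 -> `|parent_density p u - g u| <= e1) ->
  (forall u v, 0 <= u <= 1 -> 0 <= v <= 1 -> `|u - v| < h -> `|g u - g v| <= e2) ->
  forall j u, (j < m)%N -> (k j)%:R / M%:R < u <= (k j.+1)%:R / M%:R ->
  `|group_mean k p j - g u| <= e1 + e2.
Proof.
move=> M_gt0 kM wh pg gh j u jm uj.
have M0 : 0 < M%:R :> R by rewrite ltr0n.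
have -> : group_mean k p j = (k j.+1 - k j)%:R^-1 *
    \sum_(i < M | (k j <= i < k j.+1)%N) M%:R * p i.
  by rewrite /group_mean mulrCA mulr_sumr.
apply: (group_average kM) => // i /andP[ki ik].
rewrite -parent_density_right_end; set v := _ / _.
have v01 : 0 < v <= 1.
  by rewrite divr_gt0 ?ltr0n//= ler_pdivrMr// mul1r ler_nat ltn_ord.
have vj : (k j)%:R / M%:R < v <= (k j.+1)%:R / M%:R.
  by rewrite ltr_pM2r ?ler_pM2r ?invr_gt0// ltr_nat ler_nat ltnS ki.
have u01 : 0 < u <= 1.
  case/andP: uj => ju uj; rewrite (le_lt_trans _ ju) ?divr_ge0//=.
  rewrite (le_trans uj)// ler_pdivrMr// mul1r ler_nat.
  exact: (grouping_le_size kM).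
rewrite -(subrKA (g v)); apply: le_trans (ler_normD _ _) _; apply: lerD.
  exact: pg.
apply: gh; first by case/andP: v01 => /ltW -> ->.
  by case/andP: u01 => /ltW -> ->.
apply: le_lt_trans (wh j jm); rewrite (group_weightE R kM)//.
by rewrite ler_norml; move: vj uj => /andP[? ?] /andP[? ?]; apply/andP; split; lra.
Qed.

(** * The limiting distribution function *)
Section UniformSampling.
Context (d : measure_display) (T : measurableType d) (R : realType)
  (Q : probability T R) (U : {RV Q >-> R}).
Hypothesis U_uniform : uniform01 U.

Lemma uniform01_itv (a b : R) : 0 <= a -> a <= b -> b <= 1 ->
  Q (U @^-1` `]a, b]) = (b - a)%:E.
Proof.
move=> a0 ab b1; transitivity (uniform_prob (@ltr01 R) `]a, b]).
  by rewrite -U_uniform.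
rewrite /uniform_prob.
rewrite (eq_integral (fun=> 1%E)); last first.
  move=> x; rewrite inE/= in_itv/= => /andP[ax xb].
  by rewrite /uniform_pdf (le_trans a0 (ltW ax)) (le_trans xb b1)/= subr0 invr1.
rewrite integral_cst//= mul1e lebesgue_measure_itv/= lte_fin.
by move: ab; rewrite le_eqVlt => /predU1P[->|->]; rewrite ?ltxx ?subrr.
Qed.

Variables (M m : nat) (k : nat -> nat).
Hypotheses (M_gt0 : (0 < M)%N) (k_grouping : grouping M m k).

(** A union bound: outside a null set, the event is covered by the events that
    U falls in the interval of some selected group. *)
Lemma uniform01_le_groups (E : set T) (B : pred nat) : measurable E ->
  (forall w j, E w -> (j < m)%N ->
    (k j)%:R / M%:R < U w <= (k j.+1)%:R / M%:R -> B j) ->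
  (Q E <= (\sum_(j < m | B j) group_weight R M k j)%:E)%E.
Proof.
move=> mE EB.
have mU (A : set R) : measurable A -> measurable (U @^-1` A).
  by move=> mA; rewrite -[_ @^-1` _]setTI; exact: measurable_funPT.
pose C := U @^-1` `]0, 1].
have mC : measurable C by exact: mU.
have QC : Q (~` C) = 0%E.
  by rewrite probability_setC// uniform01_itv// subr0 subee.
pose A j := if B j then U @^-1` `]((k j)%:R / M%:R), ((k j.+1)%:R / M%:R)] else set0.
have mA j : measurable (A j) by rewrite /A; case: ifP => // _; exact: mU.
apply: (@le_trans _ _ (Q (E `&` C) + Q (~` C))%E).
  apply: le_trans (measureU2 _ _ _) => //; [|exact: measurableI|exact: measurableC].
  apply: le_measure; rewrite ?inE//.
    by apply: measurableU; [exact: measurableI|exact: measurableC].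
  by move=> w Ew; have [Cw|Cw] := pselect (C w); [left|right].
rewrite QC adde0.
apply: (@le_trans _ _ (\sum_(j < m) Q (A j))%E).
  apply: content_subadditive => //; first exact: measurableI.
  move=> w [Ew]; rewrite /C/= in_itv/= => /(group_cover M_gt0 k_grouping)[j jm Uj].
  rewrite -bigcup_mkord; exists j => //.
  by rewrite /A (EB w j)//= in_itv.
rewrite -sumEFin [leRHS]big_mkcond; apply: lee_sum => j _; rewrite /A.
case: ifP => _; last by rewrite measure0.
rewrite uniform01_itv ?divr_ge0 ?ler_pM2r ?invr_gt0 ?ltr0n//.
- by rewrite -(group_weightE R k_grouping).
- by rewrite ler_nat; exact/ltnW/(grouping_lt k_grouping).
- by rewrite ler_pdivrMr ?ltr0n// mul1r ler_nat (grouping_le_size k_grouping).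
Qed.

Variables (b : nat -> R) (g : R -> R) (Y : {RV Q >-> R}) (delta : R).
Hypotheses (Y_def : forall w, Y w = g (U w))
  (b_close : forall j u, (j < m)%N ->
    (k j)%:R / M%:R < u <= (k j.+1)%:R / M%:R -> `|b j - g u| <= delta).

(** The first bound comes from covering the event Y <= t by the intervals of
    the groups that meet it.  The second one comes from covering its complement
    in the same way: the groups left out have the rest of the total weight 1. *)
Lemma cdf_bounds_groups t :
  fine (cdf Y t) <= \sum_(j < m | b j <= t + delta) group_weight R M k j /\
  \sum_(j < m | b j <= t - delta) group_weight R M k j <= fine (cdf Y t).
Proof.
have mY (A : set R) : measurable A -> measurable (Y @^-1` A).
  by move=> mA; rewrite -[_ @^-1` _]setTI; exact: measurable_funPT.
have cdfE : cdf Y t = Q (Y @^-1` `]-oo, t]) by [].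
have Qfin (A : set T) : measurable A -> Q A = (fine (Q A))%:E.
  by move=> mA; rewrite fineK// fin_num_measure.
rewrite cdfE; set E := Y @^-1` _; have mE : measurable E by exact: mY.
split.
  rewrite -lee_fin -Qfin//; apply: (uniform01_le_groups (B := fun j => b j <= _)) => // w j.
  rewrite /E/= in_itv/= Y_def => gt jm /(b_close jm); rewrite ler_norml; lra.
have : (Q (~` E) <= (\sum_(j < m | ~~ (b j <= t - delta)) group_weight R M k j)%:E)%E.
  apply: (uniform01_le_groups (B := fun j => ~~ (b j <= _))); first exact: measurableC.
  move=> w j; rewrite /E/= in_itv/= Y_def => /negP; rewrite -!ltNge => gt jm.
  move=> /(b_close jm); rewrite ler_norml; lra.
rewrite probability_setC// (Qfin _ mE) -EFinB lee_fin.
rewrite -(sum_group_weight R M_gt0 k_grouping).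
rewrite (bigID (fun j : 'I_m => b j <= t - delta))/=; lra.
Qed.

End UniformSampling.

(** * Uniform continuity and conclusion *)

(** Compactness in its near-covering form: around each point of the segment,
    one h > 0 works on a neighbourhood, hence one h works on all of it. *)
Lemma unif_continuous_segment (R : realType) (a b : R) (g : R -> R) :
  {within `[a, b], continuous g} -> forall e : R, 0 < e ->
  exists2 h : R, 0 < h & forall u v, a <= u <= b -> a <= v <= b ->
    `|u - v| < h -> `|g u - g v| <= e.
Proof.
move=> /subspace_continuousP g_cont e e0.
have /compact_near_coveringP/near_covering_withinP cover := @segment_compact R a b.
have := cover R 0^'+ (fun h u => forall v, a <= v <= b ->
  `|u - v| < h -> `|g u - g v| <= e) _.
case.
  move=> u ab_u; have e20 : 0 < e / 2 by rewrite divr_gt0.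
  have /cvgrPdist_lt /(_ _ e20) := g_cont u ab_u.
  rewrite near_withinE => /nbhs_ballP[r /= r0 gr].
  exists (ball u (r / 2), [set h | h < r / 2]).
    split; first by apply: nbhsx_ballx; rewrite divr_gt0.
    by apply: nbhs_right_lt; rewrite divr_gt0.
  move=> [u' h] [/= uu' hr] ab_u' v ab_v u'v.
  rewrite /ball/= in uu'.
  have gu : `|g u - g u'| < e / 2.
    by apply: gr => //; rewrite /ball/= (lt_trans uu')//; lra.
  have gv : `|g u - g v| < e / 2.
    apply: gr; last by rewrite /= in_itv.
    rewrite /ball/= -(subrKA u'); apply: le_lt_trans (ler_normD _ _) _; lra.
  rewrite -(subrKA (g u)); apply: le_trans (ler_normD _ _) _.
  by rewrite [X in X + _]distrC; lra.
move=> r /= r0 gr; exists (r / 2); first by rewrite divr_gt0.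
move=> u v ab_u ab_v uv; apply: (gr (r / 2)) => //=.
- by rewrite sub0r normrN gtr0_norm ?divr_gt0//; lra.
- by rewrite divr_gt0.
Qed.

Theorem theorem5p1 (R : realType)
    (M : nat -> nat) (M_ge1 : forall n, (1 <= M n)%N)
    (M_rate : ~ ((fun n => (M n)%:R / n%:R : R) @ \oo --> (0 : R)))
    (p : forall n, 'I_(M n) -> R) (p_prob : forall n, probability_vector (p n))
    (d : nat -> measure_display) (T : forall n, measurableType (d n))
    (P : forall n, probability (T n) R)
    (X : forall n, 'I_(M n) -> {RV (P n) >-> nat})
    (X_multinomial : forall n, is_multinomial n (p n) (X n))
    (m : nat -> nat) (m_ge1 : forall n, (1 <= m n)%N)
    (k : nat -> nat -> nat) (k_grouping : forall n, grouping (M n) (m n) (k n))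
    (m_rate : (fun n => (m n)%:R / n%:R : R) @ \oo --> (0 : R))
    (k_mesh :
      (fun n => \big[Num.max/0]_(j < m n)
                  ((k n j.+1 - k n j)%:R / (M n)%:R) : R) @ \oo --> (0 : R))
    (g : R -> R) (g_density : density01 g)
    (g_continuous : {within `[0, 1], continuous g})
    (g_limit :
      (fun n => ereal_sup [set (`|parent_density (p n) u - g u|)%:E
                          | u in `]0, 1]]) @ \oo --> (0 : \bar R)%E)
    (d' : measure_display) (T' : measurableType d') (Q : probability T' R)
    (U : {RV Q >-> R}) (U_uniform : uniform01 U)
    (Y : {RV Q >-> R}) (Y_def : forall w, Y w = g (U w)) :
  weak_cvg_in_probability P
    (fun n w => grouped_cdf n (m n) (k n) (fun i => X n i w))
    (fun x => fine (cdf Y x)).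
Proof.
move=> e e0 x0 x0_cont; set F := fun x => fine (cdf Y x).
have e20 : 0 < e / 2 by rewrite divr_gt0.
have [r /= r0 Fr] : exists2 r, 0 < r & forall y, `|x0 - y| < r -> `|F x0 - F y| < e / 2.
  have /cvgrPdist_lt /(_ _ e20) := x0_cont.
  by move=> /nbhs_ballP[r r0 rF]; exists r => // y xy; exact: rF.
have [delta delta0 delta_r] : exists2 delta : R, 0 < delta & delta *+ 2 < r.
  by exists (r / 4); [rewrite divr_gt0|lra].
have ed0 : 0 < e / 2 * delta by rewrite mulr_gt0.
have delta20 : 0 < delta / 2 by rewrite divr_gt0.
have [h h0 gh] := unif_continuous_segment g_continuous delta20.
pose bad n (x : 'I_(M n) -> nat) := e < `|grouped_cdf n (m n) (k n) x x0 - F x0|.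
have bad_measurable n : measurable [set w | bad n (fun i => X n i w)].
  exact: (measurable_counts (X n) (bad n)).
have sup_near : \forall n \near \oo,
    forall u, 0 < u <= 1 -> `|parent_density (p n) u - g u| <= delta / 2.
  have /fine_cvgP[sup_fin /cvgrPdist_le /(_ _ delta20) sup_small] := g_limit.
  near=> n => u u01.
  have : (ereal_sup [set (`|parent_density (p n) u - g u|)%:E | u in `]0%R, 1%R]] <=
      (delta / 2)%:E)%E.
    rewrite -[leLHS]fineK; last by near: n; exact: sup_fin.
    rewrite lee_fin; apply: le_trans (ler_norm _) _; rewrite -normrN -sub0r.
    by near: n; exact: sup_small.
  rewrite -lee_fin; apply: le_trans; apply: ereal_sup_ubound.
  by exists u => //=; rewrite in_itv.
have mesh_near : \forall n \near \oo,
    forall j, (j < m n)%N -> group_weight R (M n) (k n) j < h.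
  have /cvgrPdist_lt /(_ _ h0) mesh_small := k_mesh.
  near=> n => j jm.
  apply: (@le_lt_trans _ _ (\big[Num.max/0]_(j < m n)
      ((k n j.+1 - k n j)%:R / (M n)%:R))).
    exact: (le_bigmax _ (fun j : 'I_(m n) => (k n j.+1 - k n j)%:R / (M n)%:R)
      (Ordinal jm)).
  apply: le_lt_trans (ler_norm _) _; rewrite -normrN -sub0r.
  by near: n; exact: mesh_small.
(* Markov's inequality: a bad count vector has a total deviation of at least
   e / 2 * delta, and mean_total_deviation bounds the mean of the latter. *)
have bad_bound n (c : R) : 0 < c -> (0 < n)%N ->
    (forall u, 0 < u <= 1 -> `|parent_density (p n) u - g u| <= delta / 2) ->
    (forall j, (j < m n)%N -> group_weight R (M n) (k n) j < h) ->
    (P n [set w | bad n (fun i => X n i w)] <=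
      ((e * delta)^-1 * (c^-1 + c * ((m n)%:R / n%:R)))%:E)%E.
  move=> c0 n0 sup_n mesh_n; have [p_ge0 p_sum1] := p_prob n.
  have b_close := group_mean_close (M_ge1 n) (k_grouping n) mesh_n sup_n gh.
  rewrite -splitr in b_close.
  apply: le_trans (multinomial_prob_le (p_prob n) (@X_multinomial n) (bad n)) _.
  rewrite lee_fin.
  apply: (@le_trans _ _ (multinomial_mean (p n) n (fun y =>
      (e / 2 * delta)^-1 * total_deviation n (m n) (k n) (p n) y))); last first.
    rewrite multinomial_meanZ.
    have -> : (e * delta)^-1 * (c^-1 + c * ((m n)%:R / n%:R)) =
      (e / 2 * delta)^-1 * ((c^-1 + c * ((m n)%:R / n%:R)) / 2).
      have n0' : n%:R != 0 :> R by rewrite pnatr_eq0 -lt0n.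
      by field; rewrite n0' !gt_eqF.
    rewrite ler_wpM2l ?invr_ge0 ?(ltW ed0)//.
    exact: (mean_total_deviation n0 (k_grouping n) (p_prob n) c0).
  apply: le_multinomial_mean => // y _; set S := total_deviation _ _ _ _ _.
  have S0 : 0 <= S by rewrite mulr_ge0 ?invr_ge0// sumr_ge0.
  rewrite /bad; case: ltP => [bad_y|_] /=; last first.
    by rewrite mulr_ge0// invr_ge0 mulr_ge0// ltW.
  rewrite ler_pdivlMl ?mulr_gt0// mulr1 -ler_pdivlMr//.
  have [lo hi] := grouped_cdf_sandwich (p n) n0 (M_ge1 n) (k_grouping n) y x0 delta0.
  have F_bounds := cdf_bounds_groups U_uniform (M_ge1 n) (k_grouping n)
    Y_def b_close.
  have [_ Flo] := F_bounds (x0 + delta *+ 2).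
  have [Fhi _] := F_bounds (x0 - delta *+ 2).
  change (fine _) with (F (x0 + delta *+ 2)) in Flo.
  change (fine _) with (F (x0 - delta *+ 2)) in Fhi.
  have xp : x0 + delta *+ 2 - delta = x0 + delta by ring.
  have xm : x0 - delta *+ 2 + delta = x0 - delta by ring.
  rewrite xp in Flo; rewrite xm in Fhi.
  have Fp : `|F x0 - F (x0 + delta *+ 2)| < e / 2.
    by apply: Fr; rewrite ltr_norml; lra.
  have Fm : `|F x0 - F (x0 - delta *+ 2)| < e / 2.
    by apply: Fr; rewrite ltr_norml; lra.
  rewrite -/S in lo hi.
  move: bad_y Fp Fm; rewrite !ltr_norml ltr_normr.
  by case/orP => bad_y /andP[Fp Fp'] /andP[Fm Fm']; lra.
apply/fine_cvgP; split.
  by near=> n; apply: fin_num_measure; exact: bad_measurable.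
apply/cvgrPdist_le => eta eta0.
(* This c makes c^-1 / (e * delta) equal to eta / 2; the other half of eta
   comes from c * (m / n) <= c^-1. *)
pose c := 2 / (eta * e * delta).
have c0 : 0 < c by rewrite divr_gt0// !mulr_gt0.
have ci0 : 0 < c^-1 ^+ 2 by rewrite exprn_gt0// invr_gt0.
have /cvgrPdist_le /(_ _ ci0) m_small := m_rate.
near=> n.
rewrite sub0r normrN ger0_norm ?fine_ge0//.
rewrite -lee_fin fineK; last by apply: fin_num_measure; exact: bad_measurable.
apply: le_trans (bad_bound n c c0 _ _ _) _.
- by near: n; exact: nbhs_infty_gt.
- by near: n.
- by near: n.
rewrite lee_fin.
have mn : (m n)%:R / n%:R <= c^-1 ^+ 2.
  apply: le_trans (ler_norm _) _; rewrite -normrN -sub0r.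
  by near: n; exact: m_small.
have -> : eta = (e * delta)^-1 * (c^-1 + c * c^-1 ^+ 2).
  by rewrite /c; field; rewrite !gt_eqF.
rewrite ler_wpM2l ?invr_ge0 ?(ltW (mulr_gt0 e0 delta0))//.
by rewrite lerD2l ler_wpM2l// ltW.
Unshelve. all: by end_near. Qed.
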